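(* Let $H$ be a finite dimensional complex Hilbert space and let $\alpha:\mathcal{B}(H)\to\mathcal{B}(H)$ be a non-zero completely positive map which is nilpotent of order $p$. Let $M$ be a subspace of $H$ that is invariant under $\alpha$, let $N=M^\perp$, and let $\beta:\mathcal{B}(M)\to\mathcal{B}(M)$ and $\gamma:\mathcal{B}(N)\to\mathcal{B}(N)$ be the completely positive maps obtained from $\alpha$ as described in the context (both are nilpotent of order at most $p$). Let $(a_1,\dots,a_p)$, $(b_1,\dots,b_p)$, $(c_1,\dots,c_p)$ be the CP nilpotent types of $\alpha,\beta,\gamma$ respectively, where $b_i=0$ when $i$ is bigger than the order of nilpotency of $\beta$ and $c_i=0$ when $i$ is bigger than the order of nilpotency of $\gamma$. Then $$\sum_{i=1}^k a_i\le\sum_{i=1}^k b_i+\sum_{i=1}^k c_i\quad\text{for all }1\le k\le p,$$ and $$\sum_{i=1}^p a_i=\sum_{i=1}^p b_i+\sum_{i=1}^p c_i.$$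
   Context: $\mathcal{B}(H)$ is the algebra of all linear maps on $H$ and $1$ denotes the identity. A linear map $A$ is nilpotent of order $p$ if $A^p=0$ and $p$ is the smallest such number. For a completely positive map $\theta$ on $\mathcal{B}(K)$ ($K$ a finite dimensional Hilbert space) nilpotent of order $q$, its CP nilpotent type is the tuple $(\dim K_1,\dots,\dim K_q)$, where $K_1=\ker(\theta(1))$ and $K_k=\ker(\theta^k(1))\cap(\ker(\theta^{k-1}(1)))^\perp$ for $2\le k\le q$; one has $K=K_1\oplus\cdots\oplus K_q$. For a subspace $M\subseteq H$ and $N=M^\perp$, the space $\mathcal{B}(M)$ is regarded as a subspace of $\mathcal{B}(H)$ by identifying $X\in\mathcal{B}(M)$ with the block operator $\begin{bmatrix} X & 0 \\ 0 & 0 \end{bmatrix}$ with respect to $H=M\oplus N$. The subspace $M$ is said to be invariant under $\alpha$ if $\alpha$ leaves $\mathcal{B}(M)$ invariant. If $\alpha(X)=\sum_{i=1}^d L_i^*XL_i$ ($L_i\in\mathcal{B}(H)$) is a Choi-Kraus decomposition of $\alpha$, this happens if and only if every $L_i$ leaves $N$ invariant, so that with respect to $H=M\oplus N$ $$L_i=\begin{bmatrix} B_i & 0 \\ D_i & C_i \end{bmatrix},\qquad B_i\in\mathcal{B}(M),\ C_i\in\mathcal{B}(N),\ D_i\in\mathcal{B}(M,N).$$ Then $\beta$ and $\gamma$ are defined by $\beta(X)=\sum_{i=1}^d B_i^*XB_i$ for $X\in\mathcal{B}(M)$ and $\gamma(X)=\sum_{i=1}^d C_i^*XC_i$ for $X\in\mathcal{B}(N)$.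 *)

(* Defs.v *)
From HB Require Import structures.
From mathcomp Require Import all_boot all_order all_algebra.
From mathcomp Require Import complex reals.

Set Implicit Arguments.
Unset Strict Implicit.
Unset Printing Implicit Defensive.

Import Order.TTheory GRing.Theory Num.Theory Num.Def.

Local Open Scope ring_scope.

(* A finite dimensional complex Hilbert space is a pair of a vector space     *)
(* H : vectType C and an inner product form : {dot H for conjC}, which is     *)
(* linear in its first argument and conjugate-linear in the second.  B(H) is  *)
(* 'End(H).                                                                   *)

Section SubHilbert.
Variables (C : numClosedFieldType) (H : vectType C).
Variables (form : {dot H for conjC}) (M : {vspace H}).

Definition sub_dot (u v : subvs_of M) : C := form (vsval u) (vsval v).

Fact sub_dot_bilinear :
  bilinear_for (GRing.Scale.Law.clone _ _ ( *%R ) _)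
    (GRing.Scale.Law.clone _ _ (conjC \; *%R ) _) sub_dot.
Proof.
have vsvalP a (x y : subvs_of M) : vsval (a *: x + y) = a *: vsval x + vsval y.
  by rewrite linearP.
split=> [v|u] a x y; rewrite /sub_dot vsvalP.
- by rewrite linearDl linearZl_LR.
- by rewrite linearDr linearZr_LR.
Qed.

HB.instance Definition _ := bilinear_isBilinear.Build C
  (subvs_of M) (subvs_of M) C _ _ sub_dot sub_dot_bilinear.

Fact sub_dot_herm u v : sub_dot u v = (-1) ^+ false * (sub_dot v u)^*.
Proof. exact: hermC. Qed.

HB.instance Definition _ :=
  isHermitianSesquilinear.Build C (subvs_of M) false conjC sub_dot
    sub_dot_herm.

Fact sub_dot_gt0 u : u != 0 -> 0 < sub_dot u u.
Proof. by move=> u0; apply: neq0_dnorm_gt0; rewrite -(inj_eq val_inj) in u0. Qed.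

HB.instance Definition _ :=
  isDotProduct.Build C (subvs_of M) sub_dot sub_dot_gt0.

End SubHilbert.
Arguments sub_dot {C H} form M u v.

Section Adjoint.
Variables (C : numClosedFieldType) (U V : vectType C).
Variables (formU : {dot U for conjC}) (formV : {dot V for conjC}).

Let n : nat := \dim {:U}.
Let e (i : 'I_n) : U := (vbasis {:U})`_i.

Definition gram_row (u : U) : 'rV[C]_n := \row_i formU u (e i).
Definition adjoint_row (f : 'Hom(U, V)) (v : V) : 'rV[C]_n :=
  \row_i formV v (f (e i)).

Fact gram_row_linear : linear gram_row.
Proof. by move=> a u v; apply/rowP=> i; rewrite !mxE linearDl linearZl_LR. Qed.

HB.instance Definition _ :=
  GRing.isLinear.Build C U 'rV[C]_n _ gram_row gram_row_linear.

Fact adjoint_row_linear f : linear (adjoint_row f).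
Proof. by move=> a u v; apply/rowP=> i; rewrite !mxE linearDl linearZl_LR. Qed.

HB.instance Definition _ f :=
  GRing.isLinear.Build C V 'rV[C]_n _ (adjoint_row f) (adjoint_row_linear f).

(* The adjoint f^* of f with respect to formU and formV, characterized by     *)
(* adjointP and adjoint_uniq: f^* v is the solution w of the linear system    *)
(* formU w (e i) = formV v (f (e i)).                                         *)
Definition adjoint (f : 'Hom(U, V)) : 'Hom(V, U) :=
  ((linfun gram_row)^-1 \o linfun (adjoint_row f))%VF.

Lemma dot_vbasis_eq (u w : U) :
  (forall i : 'I_n, formU u (e i) = formU w (e i)) -> u = w.
Proof.
move=> uw; apply/eqP; rewrite -subr_eq0 -(dnorm_eq0 formU); apply/eqP.
rewrite {2}(coord_vbasis (memvf (u - w))) linear_sumr big1 // => i _.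
rewrite linearZr_LR /=; apply/eqP; rewrite mulf_eq0; apply/orP; right.
by rewrite linearBl subr_eq0; apply/eqP; exact: uw.
Qed.

Lemma adjoint_vbasis f v (i : 'I_n) :
  formU (adjoint f v) (e i) = formV v (f (e i)).
Proof.
have inj : lker (linfun gram_row) == 0%VS.
  apply/lker0P=> u w; rewrite !lfunE /= => /rowP uw.
  by apply: dot_vbasis_eq => j; have := uw j; rewrite !mxE.
have surj : limg (linfun gram_row) = fullv.
  apply/eqP; rewrite eqEdim subvf /= limg_dim_eq; last first.
    by rewrite (eqP inj) capv0.
  by rewrite [leqLHS]dimvf /dim /= mul1n.
have /rowP/(_ i) : gram_row (adjoint f v) = adjoint_row f v.
  have -> w : gram_row w = linfun gram_row w by rewrite lfunE.
  rewrite comp_lfunE limg_lfunVK ?surj ?memvf //.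
  by rewrite lfunE.
by rewrite !mxE.
Qed.

Lemma adjointP (f : 'Hom(U, V)) u v : formV (f u) v = formU u (adjoint f v).
Proof.
rewrite [LHS]hermC [RHS]hermC /=; congr (_ * _^*).
rewrite (coord_vbasis (memvf u)) linear_sum !linear_sumr.
by apply: eq_bigr => i _; rewrite linearZ !linearZr_LR /= adjoint_vbasis.
Qed.

Lemma adjoint_uniq (f : 'Hom(U, V)) (g : 'Hom(V, U)) :
  (forall u v, formV (f u) v = formU u (g v)) -> g = adjoint f.
Proof.
move=> fg; apply/lfunP=> v; apply: dot_vbasis_eq => i.
by rewrite [LHS]hermC [RHS]hermC /= -fg -adjointP.
Qed.

End Adjoint.

Section CompletelyPositive.
Variables (C : numClosedFieldType) (H : vectType C).
Variable form : {dot H for conjC}.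

(* Positivity of [X_ij] in M_n(B(H)), acting on H (+) ... (+) H.              *)
Definition block_positive n (X : 'I_n -> 'I_n -> 'End(H)) : Prop :=
  forall h : 'I_n -> H, 0 <= \sum_i \sum_j form (X i j (h j)) (h i).

Definition completely_positive (theta : 'End(H) -> 'End(H)) : Prop :=
  forall n (X : 'I_n -> 'I_n -> 'End(H)),
    block_positive X -> block_positive (fun i j => theta (X i j)).

Definition kraus_map d (L : 'I_d -> 'End(H)) (X : 'End(H)) : 'End(H) :=
  \sum_i (adjoint form form (L i) \o X \o L i)%VF.

Definition choi_kraus (theta : 'End(H) -> 'End(H)) d (L : 'I_d -> 'End(H)) :
    Prop :=
  forall X, theta X = kraus_map L X.

(* The order is a positive integer, so that the zero map has order 1, also on *)
(* the zero space.                                                            *)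
Definition nilpotent_of_order (V : zmodType) (A : V -> V) (p : nat) : Prop :=
  [/\ (0 < p)%N, forall x, iter p A x = 0 &
      forall q, (0 < q)%N -> (forall x, iter q A x = 0) -> (p <= q)%N].

Definition ker_pow (theta : 'End(H) -> 'End(H)) (k : nat) : {vspace H} :=
  lker (iter k theta \1%VF).

Definition nil_space (theta : 'End(H) -> 'End(H)) (k : nat) : {vspace H} :=
  if (k <= 1)%N then ker_pow theta 1
  else (ker_pow theta k :&: orthov form (ker_pow theta k.-1))%VS.

(* The tuple (dim K_1, ..., dim K_q); the default value 0 of nth gives the    *)
(* convention that the entries beyond q vanish.                               *)
Definition cp_nilpotent_type (theta : 'End(H) -> 'End(H)) (q : nat) : seq nat :=
  [seq \dim (nil_space theta k) | k <- iota 1 q].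

Section Blocks.
Variable M : {vspace H}.

Definition incl : 'Hom(subvs_of M, H) := linfun vsval.

(* vsproj alone projects along M^C, which is not the orthogonal complement.   *)
Definition oproj : 'Hom(H, subvs_of M) :=
  (linfun (vsproj M) \o daddv_pi M (orthov form M))%VF.

(* The block operator with upper left entry X and other entries 0.            *)
Definition embed (X : 'End(subvs_of M)) : 'End(H) := (incl \o X \o oproj)%VF.

(* The diagonal entry, at M, of the block matrix of A.                        *)
Definition diag_block (A : 'End(H)) : 'End(subvs_of M) :=
  (oproj \o A \o incl)%VF.

Definition invariant_under (theta : 'End(H) -> 'End(H)) : Prop :=
  forall X : 'End(subvs_of M), exists Y : 'End(subvs_of M),
    theta (embed X) = embed Y.

Lemma capv_orthov : (M :&: orthov form M)%VS = 0%VS.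
Proof.
apply/eqP; rewrite -subv0; apply/subvP=> u; rewrite memv_cap => /andP[uM].
by move=> /mem_orthovP/(_ u uM)/eqP; rewrite dnorm_eq0 memv0.
Qed.

Lemma inclE u : incl u = vsval u.
Proof. by rewrite lfunE. Qed.

Lemma addv_orthov : (M + orthov form M)%VS = fullv.
Proof.
apply/eqP; rewrite eqEsubv subvf /=; apply/subvP=> x _.
pose y := adjoint (sub_dot form M) form incl x.
apply/memv_addP; exists (vsval y); first exact: subvsP.
exists (x - vsval y); last by rewrite addrC subrK.
apply/mem_orthovP=> v vM; rewrite linearBl; apply/eqP; rewrite subr_eq0.
apply/eqP; suff E : form x v = form (vsval y) v by exact: E.
rewrite -(vsprojK vM) hermC [RHS]hermC -{1}inclE; congr (_ * conjC _).
exact: (adjointP (sub_dot form M) form).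
Qed.

Lemma vsval_oproj x : vsval (oproj x) = daddv_pi M (orthov form M) x.
Proof. by rewrite comp_lfunE lfunE vsprojK // memv_pi. Qed.

Lemma oprojP x : x - vsval (oproj x) \in orthov form M.
Proof.
have xMN : x \in (M + orthov form M)%VS by rewrite addv_orthov memvf.
rewrite vsval_oproj -{1}(daddv_pi_add capv_orthov xMN) addrC addKr.
exact: memv_pi.
Qed.

Lemma adjoint_incl : adjoint (sub_dot form M) form incl = oproj.
Proof.
apply/esym/adjoint_uniq=> u v; rewrite inclE /sub_dot.
have /mem_orthovP/(_ _ (subvsP u)) E := oprojP v.
have E' : form (vsval u) (v - vsval (oproj v)) = 0.
  by rewrite hermC; apply/eqP; rewrite mulf_eq0 conjC_eq0 (introT eqP E) orbT.
by apply/eqP; rewrite -subr_eq0; apply/eqP; rewrite -[RHS]E' linearBr.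
Qed.

End Blocks.

End CompletelyPositive.

Arguments incl {C H} M.
Arguments oproj {C H} form M.
Arguments embed {C H} form M X.
Arguments diag_block {C H} form M A.
Arguments invariant_under {C H} form M theta.

(* Main.v *)
(* Put K_k(L) = ker (theta^k(1)) for theta = kraus_map L.  By positivity, v is
   in K_(k+1)(L) iff every L_i v is in K_k(L); hence K_k(L) is the common kernel of
   the words of length k in the L_i, it increases with k, and
   a_1 + ... + a_k = dim K_k(L).  Invariance of M under alpha makes N invariant
   under every L_i, so the orthogonal projection onto M intertwines L_i with B_i
   and maps K_k(L) into K_k(B), while its kernel on K_k(L) is the intersection
   of K_k(L) with N, which is contained in K_k(C).  For k = p all three kernels
   are full. *)

Require Import Defs.
From HB Require Import structures.
From mathcomp Require Import all_boot all_order all_algebra.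
From mathcomp Require Import complex reals.

Set Implicit Arguments.
Unset Strict Implicit.
Unset Printing Implicit Defensive.

Import Order.TTheory GRing.Theory Num.Theory Num.Def.

Local Open Scope ring_scope.

(** * Kernels of the powers of a Kraus map *)

Section KrausKernels.
Variables (C : numClosedFieldType) (H : vectType C) (form : {dot H for conjC}).
Variables (d : nat) (L : 'I_d -> 'End(H)).
Local Notation theta := (kraus_map form L).

Lemma kraus_mapE X v :
  theta X v = \sum_i adjoint form form (L i) (X (L i v)).
Proof.
by rewrite /kraus_map sum_lfunE; apply: eq_bigr => i _; rewrite !comp_lfunE.
Qed.

Lemma dot_kraus_map X u v :
  form (theta X u) v = \sum_i form (X (L i u)) (L i v).
Proof.
rewrite kraus_mapE linear_sumlz; apply: eq_bigr => i _.
by rewrite /= [LHS]hermC [RHS]hermC /= -adjointP.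
Qed.

Lemma dot_iter_kraus_map_ge0 k v : 0 <= form (iter k theta \1%VF v) v.
Proof.
elim: k v => [|k IHk] v; first by rewrite id_lfunE dnorm_ge0.
by rewrite iterS dot_kraus_map sumr_ge0.
Qed.

(** The quadratic form at [v] is a sum of nonnegative quadratic forms at the [L i v], so each
    summand vanishes. Descending to length 0, every word of length [k] in the [L i] kills [v],
    whatever operator [X] stands in the middle. *)
Lemma iter_kraus_map_eq0 k v : form (iter k theta \1%VF v) v = 0 ->
  forall X, iter k theta X v = 0.
Proof.
elim: k v => [|k IHk] v.
  by rewrite id_lfunE => /eqP; rewrite dnorm_eq0 => /eqP-> X; rewrite linear0.
rewrite iterS dot_kraus_map => /eqP; rewrite psumr_eq0 => [/allP v0 X|i _].
  rewrite iterS kraus_mapE big1 // => i _.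
  by rewrite IHk ?linear0 //; apply/eqP; apply: v0; rewrite mem_index_enum.
exact: dot_iter_kraus_map_ge0.
Qed.

Lemma mem_ker_powP k v :
  reflect (forall X, iter k theta X v = 0) (v \in ker_pow theta k).
Proof.
apply: (iffP idP) => [|v0]; last by rewrite memv_ker v0.
rewrite memv_ker => /eqP v0; apply: iter_kraus_map_eq0.
by rewrite v0 linear0l.
Qed.

Lemma mem_ker_pow0 v : (v \in ker_pow theta 0) = (v == 0).
Proof. by rewrite memv_ker id_lfunE. Qed.

Lemma mem_ker_powS k v :
  (v \in ker_pow theta k.+1) = [forall i, L i v \in ker_pow theta k].
Proof.
apply/idP/forallP => [|Lv].
  rewrite memv_ker => /eqP v0 i.
  have /eqP : form (iter k.+1 theta \1%VF v) v = 0 by rewrite v0 linear0l.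
  rewrite iterS dot_kraus_map psumr_eq0 => [/allP/(_ i)|j _]; last first.
    exact: dot_iter_kraus_map_ge0.
  rewrite mem_index_enum => /(_ isT)/eqP/iter_kraus_map_eq0 Lv0.
  exact/mem_ker_powP.
apply/mem_ker_powP => X; rewrite iterS kraus_mapE big1 // => i _.
by have /mem_ker_powP-> := Lv i; rewrite linear0.
Qed.

Lemma ker_pow_subS k : (ker_pow theta k <= ker_pow theta k.+1)%VS.
Proof.
elim: k => [|k IHk]; apply/subvP => v.
  by rewrite mem_ker_pow0 => /eqP->; rewrite mem0v.
rewrite mem_ker_powS => /forallP Lv; rewrite mem_ker_powS.
by apply/forallP => i; apply: (subvP IHk).
Qed.

Lemma ker_pow_sub j k :
  (j <= k)%N -> (ker_pow theta j <= ker_pow theta k)%VS.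
Proof.
by apply: (homo_leq (r := fun U V => U <= V)%VS) => [U|V U W|i];
  [exact: subvv | exact: subv_trans | exact: ker_pow_subS].
Qed.

Lemma ker_pow_full k :
  (ker_pow theta k == fullv) <-> (forall X, iter k theta X = 0).
Proof.
split=> [/eqP full X|theta0].
  apply/lfunP => v; rewrite lfunE /=.
  by move: X; apply/mem_ker_powP; rewrite full memvf.
rewrite eqEsubv subvf; apply/subvP => v _.
by apply/mem_ker_powP => X; rewrite theta0 lfunE.
Qed.

(** * Partial sums of the type and the order of nilpotency *)

Lemma dim_nil_spaceS k :
  (\dim (ker_pow theta k) + \dim (nil_space form theta k.+1) =
   \dim (ker_pow theta k.+1))%N.
Proof.
case: k => [|k].
  suff ->: ker_pow theta 0 = 0%VS by rewrite dimv0.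
  by apply/vspaceP => v; rewrite mem_ker_pow0 memv0.
(* By the modular law, the smaller kernel and its orthogonal complement inside the larger one add up
   to the larger one. *)
rewrite /nil_space /= capvC -dimv_disjoint_sum.
  by rewrite vspace_modl ?ker_pow_subS // addv_orthov capfv.
by rewrite capvA capv_orthov cap0v.
Qed.

Lemma sum_cp_nilpotent_type q k : (k <= q)%N ->
  (\sum_(i < k) nth 0 (cp_nilpotent_type form theta q) i)%N =
  \dim (ker_pow theta k).
Proof.
elim: k => [_|k IHk lt_kq].
  rewrite big_ord0; apply/esym/eqP; rewrite dimv_eq0 -subv0.
  by apply/subvP => v; rewrite mem_ker_pow0 memv0.
rewrite big_ord_recr /= IHk 1?ltnW // (nth_map 0) ?size_iota // nth_iota //.
by rewrite add1n dim_nil_spaceS.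
Qed.

(** From [q] on the kernels are all full, while entries of the type past [q] read as 0. So types
    recorded with different lengths can be summed up to a common [k]. *)
Lemma sum_cp_nilpotent_type_ge q k : ker_pow theta q = fullv ->
  (\sum_(i < k) nth 0 (cp_nilpotent_type form theta q) i)%N =
  \dim (ker_pow theta k).
Proof.
move=> full; have [/sum_cp_nilpotent_type-> //|lt_qk] := leqP k q.
have ->: ker_pow theta k = ker_pow theta q.
  by apply/eqP; rewrite eqEsubv {1}full subvf ker_pow_sub ?(ltnW lt_qk).
rewrite -(sum_cp_nilpotent_type (leqnn q)) -!(big_mkord xpredT).
rewrite (big_cat_nat (n := q)) ?(ltnW lt_qk) //=.
rewrite [X in (_ + X)%N]big1_seq ?addn0 // => i /andP[_].
rewrite mem_index_iota => /andP[le_qi _].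
by rewrite nth_default // size_map size_iota.
Qed.

(** A full kernel at exponent [q] means that the [q]-th iterate is zero, so the least such [q] is
    the order. Positivity must be imposed: on the zero space exponent 0 already gives a full
    kernel. *)
Lemma nilpotent_order_exists p : (0 < p)%N -> ker_pow theta p = fullv ->
  exists q, [/\ nilpotent_of_order theta q, (q <= p)%N &
    ker_pow theta q = fullv].
Proof.
move=> p_gt0 full.
have exq : exists q, (0 < q)%N && (ker_pow theta q == fullv).
  by exists p; rewrite p_gt0 full eqxx.
have [q /andP[q_gt0 fullq] q_min] := ex_minnP exq.
exists q; split; last exact/eqP.
  split=> // [|k k_gt0 theta0]; first exact/ker_pow_full.
  by apply: q_min; rewrite k_gt0; apply/ker_pow_full.
by apply: q_min; rewrite p_gt0 full eqxx.
Qed.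

(** * Orthogonal projections and invariant subspaces *)

Section Invariant.
Variable M : {vspace H}.
Local Notation N := (orthov form M).

Lemma embedE X v : embed form M X v = vsval (X (oproj form M v)).
Proof. by rewrite -inclE !comp_lfunE. Qed.

Lemma diag_blockE A v : diag_block form M A v = oproj form M (A (vsval v)).
Proof. by rewrite -inclE !comp_lfunE. Qed.

Lemma oproj_eq0 x : (oproj form M x == 0) = (x \in N).
Proof.
apply/eqP/idP => [x0|xN].
  by have := oprojP form M x; rewrite x0 (linear0 vsval) subr0.
apply: val_inj => /=; apply/eqP; rewrite -memv0 -(capv_orthov form M) memv_cap.
rewrite subvsP; have := rpredB xN (oprojP form M x).
by rewrite opprB addrC subrK.
Qed.

Lemma oproj_vsval (x : subvs_of M) : oproj form M (vsval x) = x.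
Proof.
apply/val_inj/esym/eqP; rewrite -subr_eq0 -memv0 -(capv_orthov form M) memv_cap.
by rewrite oprojP rpredB ?subvsP.
Qed.

Lemma lker_oproj : lker (oproj form M) = N.
Proof. by apply/vspaceP => x; rewrite memv_ker oproj_eq0. Qed.

(* The vectors of [N] are killed by [embed Y], and [theta (embed 1)] has
   quadratic form [v |-> \sum_i |P_M (L i v)|^2]. *)
Lemma invariant_under_orthov : invariant_under form M theta ->
  forall i v, v \in N -> L i v \in N.
Proof.
move=> /(_ \1%VF)[Y thetaP] i v vN.
have dotP u : form (embed form M \1%VF u) u =
    sub_dot form M (oproj form M u) (oproj form M u).
  rewrite embedE id_lfunE -inclE.
  by rewrite (adjointP (sub_dot form M) form) adjoint_incl.
have /eqP : form (theta (embed form M \1%VF) v) v = 0.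
  rewrite thetaP embedE; move: vN; rewrite -oproj_eq0 => /eqP->.
  by rewrite linear0 (linear0 vsval) linear0l.
rewrite dot_kraus_map psumr_eq0 => [/allP/(_ i)|j _]; last first.
  by rewrite dotP dnorm_ge0.
by rewrite mem_index_enum dotP dnorm_eq0 oproj_eq0; apply.
Qed.

End Invariant.
End KrausKernels.

(** * Comparison with the kernels of the diagonal blocks *)

Section Blocks.
Variables (C : numClosedFieldType) (H : vectType C) (form : {dot H for conjC}).
Variables (d : nat) (L : 'I_d -> 'End(H)) (M : {vspace H}).
Local Notation N := (orthov form M).
Local Notation theta := (kraus_map form L).
Local Notation beta :=
  (kraus_map (sub_dot form M) (fun i => diag_block form M (L i))).
Local Notation gamma :=
  (kraus_map (sub_dot form N) (fun i => diag_block form N (L i))).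
Hypothesis LN : forall i v, v \in N -> L i v \in N.

(** The difference between [v] and its projection lies in [N], hence so does its image under [L i],
    which the projection then kills. *)
Lemma diag_block_oproj i v :
  diag_block form M (L i) (oproj form M v) = oproj form M (L i v).
Proof.
rewrite !diag_blockE; apply/eqP.
by rewrite -subr_eq0 -!linearB oproj_eq0 LN // -rpredN opprB oprojP.
Qed.

Lemma oproj_ker_pow k v :
  v \in ker_pow theta k -> oproj form M v \in ker_pow beta k.
Proof.
elim: k v => [|k IHk] v.
  by rewrite !mem_ker_pow0 => /eqP->; rewrite linear0.
rewrite !mem_ker_powS => /forallP Lv; apply/forallP => i.
by rewrite diag_block_oproj IHk.
Qed.

Lemma vsval_diag_block i (v : subvs_of N) :
  vsval (diag_block form N (L i) v) = L i (vsval v).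
Proof.
rewrite diag_blockE.
have LvN : L i (vsval v) \in N by rewrite LN ?subvsP.
by rewrite -{1}(vsprojK LvN) oproj_vsval vsprojK.
Qed.

(** On [N] the lower block is the restriction of [L i], so the words in both agree there. *)
Lemma vsval_ker_pow k (v : subvs_of N) :
  vsval v \in ker_pow theta k -> v \in ker_pow gamma k.
Proof.
elim: k v => [|k IHk] v; first by rewrite !mem_ker_pow0.
rewrite !mem_ker_powS => /forallP Lv; apply/forallP => i.
by rewrite IHk // vsval_diag_block.
Qed.

Lemma dim_ker_pow_le k :
  (\dim (ker_pow theta k) <= \dim (ker_pow beta k) + \dim (ker_pow gamma k))%N.
Proof.
(* Rank-nullity for the projection restricted to [ker_pow theta k]. *)
rewrite -(limg_ker_dim (oproj form M) (ker_pow theta k)) addnC leq_add //.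
  by apply: dimvS; apply/subvP => _ /memv_imgP[v vK ->]; exact: oproj_ker_pow.
(* The kernel for [gamma] is moved into [H] by the inclusion; only the image term of rank-nullity is
   kept. *)
rewrite -(limg_ker_dim (incl N) (ker_pow gamma k)).
apply: leq_trans (leq_addl _ _).
apply: dimvS; apply/subvP => v; rewrite lker_oproj memv_cap => /andP[vK vN].
apply/memv_imgP; exists (vsproj N v); last by rewrite inclE vsprojK.
by apply: vsval_ker_pow; rewrite vsprojK.
Qed.

Lemma ker_pow_diag_full k : ker_pow theta k = fullv ->
  ker_pow beta k = fullv /\ ker_pow gamma k = fullv.
Proof.
move=> full; split; apply/vspaceP => v; rewrite memvf.
  by rewrite -(oproj_vsval form v) oproj_ker_pow // full memvf.
by apply: vsval_ker_pow; rewrite full memvf.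
Qed.

Lemma dim_orthov : (\dim {:subvs_of M} + \dim {:subvs_of N} = \dim {:H})%N.
Proof.
rewrite -(addv_orthov form M) dimv_disjoint_sum ?capv_orthov //.
by rewrite !dimvf.
Qed.

End Blocks.

Theorem theorem3p1 (R : realType) (H : vectType R[i])
    (form : {dot H for conjC})
    (alpha : {linear 'End(H) -> 'End(H)}) (p : nat) (M : {vspace H})
    (d : nat) (L : 'I_d -> 'End(H)) :
  completely_positive form alpha ->
  (exists X, alpha X <> 0) ->
  nilpotent_of_order alpha p ->
  invariant_under form M alpha ->
  choi_kraus form alpha L ->
  let N := orthov form M in
  let beta := kraus_map (sub_dot form M) (fun i => diag_block form M (L i)) in
  let gamma := kraus_map (sub_dot form N) (fun i => diag_block form N (L i)) in
  exists q r : nat,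
    [/\ nilpotent_of_order beta q /\ (q <= p)%N,
        nilpotent_of_order gamma r /\ (r <= p)%N &
        let a := cp_nilpotent_type form alpha p in
        let b := cp_nilpotent_type (sub_dot form M) beta q in
        let c := cp_nilpotent_type (sub_dot form N) gamma r in
        (forall k, (1 <= k <= p)%N ->
           (\sum_(i < k) nth 0 a i
              <= \sum_(i < k) nth 0 b i + \sum_(i < k) nth 0 c i)%N)
        /\ (\sum_(i < p) nth 0 a i
              = \sum_(i < p) nth 0 b i + \sum_(i < p) nth 0 c i)%N].
Proof.
move=> _ _ [p_gt0 alpha0 _] invM alphaL N beta gamma.
(* [alpha] and its Kraus map agree only pointwise, so the transfer goes through iterates. *)
have iter_alpha k X : iter k alpha X = iter k (kraus_map form L) X.
  by apply: eq_iter => Y; exact: alphaL.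
have fullp : ker_pow (kraus_map form L) p = fullv.
  by apply/eqP/ker_pow_full => X; rewrite -iter_alpha.
have LN : forall i v, v \in orthov form M -> L i v \in orthov form M.
  apply: invariant_under_orthov => X.
  by have [Y alphaX] := invM X; exists Y; rewrite -alphaL.
have [betap gammap] := ker_pow_diag_full LN fullp.
have [q [nilq le_qp fullq]] := nilpotent_order_exists p_gt0 betap.
have [r [nilr le_rp fullr]] := nilpotent_order_exists p_gt0 gammap.
exists q, r; split=> // a b c.
have -> : a = cp_nilpotent_type form (kraus_map form L) p.
  by apply: eq_map => k; rewrite /nil_space /ker_pow !iter_alpha.
split=> [k /andP[_ le_kp]|].
  by rewrite !sum_cp_nilpotent_type_ge // dim_ker_pow_le.
by rewrite !sum_cp_nilpotent_type_ge // fullp betap gammap dim_orthov.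
Qed.
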